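(* Let $\mathcal A'$ be a hyperplane arrangement in $\mathbb K^3$, let $H\notin\mathcal A'$ be a linear plane in $\mathbb K^3$, and let $\mathcal A:=\mathcal A'\cup\{H\}$ (with $\mathcal A$ and $\mathcal A'$ essential). Assume that $r(\mathcal A')=r'$. If $|\mathcal A^H|\ge r'+2$, then $r(\mathcal A)=r'+1$.
   Context: $\mathbb K$ is a field of characteristic zero, $S=\mathbb K[x_1,x_2,x_3]$ with the standard grading, and $\operatorname{Der} S=\bigoplus_{i=1}^3 S\,\partial_{x_i}$, where $\sum a_i\partial_{x_i}$ is homogeneous of degree $e$ if all $a_i\in S_e$. A hyperplane arrangement in $\mathbb K^3$ is a finite set of (distinct) linear planes of $\mathbb K^3$ (equivalently, a line arrangement in $\mathbb P^2$); it is essential if the planes intersect only in $0$. For each plane $H$ fix a linear form $\alpha_H$ with $\ker\alpha_H=H$, and let $Q(\mathcal A)=\prod_{H\in\mathcal A}\alpha_H$. Let $D_0(\mathcal A)=\{\theta\in\operatorname{Der}S\mid \theta(Q(\mathcal A))=0\}$ and $r(\mathcal A)=\min\{e\mid D_0(\mathcal A)_e\ne 0\}$. For $H\in\mathcal A$, $\mathcal A^H=\{H\cap L\mid L\in\mathcal A\setminus\{H\}\}$; thus $|\mathcal A^H|$ is the number of points of $\mathbb P(H)$ at which it meets the other lines of the arrangement. *)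

(* Defs.v *)
From mathcomp Require Import all_boot all_order all_algebra.
From mathcomp Require Import finmap mpoly.

Set Implicit Arguments.
Unset Strict Implicit.
Unset Printing Implicit Defensive.

Import GRing.Theory.
Local Open Scope ring_scope.
Local Open Scope fset_scope.

Section Arrangements.
Variable K : fieldType.

Local Notation S := {mpoly K[3]}.

(* Der S is free over S on the partial derivatives, so a derivation is given
   by its tuple of coefficients; [theta i] is the coefficient of the i-th
   partial derivative. *)
Definition derivation := {ffun 'I_3 -> S}.

Definition der_app (theta : derivation) (f : S) : S :=
  \sum_(i < 3) theta i * f^`M(i).

Definition der_homog (e : nat) (theta : derivation) : Prop :=
  forall i : 'I_3, theta i \is e.-homog.

Definition plane (L : {vspace 'rV[K]_3}) : Prop := \dim L = 2.

Definition arrangement (A : {fset {vspace 'rV[K]_3}}) : Prop :=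
  forall L, L \in A -> plane L.

Definition essential (A : {fset {vspace 'rV[K]_3}}) : Prop :=
  (\bigcap_(L <- A) L)%VS = 0%VS.

(* A linear form with kernel L; [v 0] is the row vector v as a point. *)
Definition defining_form (L : {vspace 'rV[K]_3}) (a : S) : Prop :=
  a \is 1.-homog /\ forall v : 'rV[K]_3, (v \in L) <-> a.@[v 0] = 0.

Definition defining_poly (alpha : {vspace 'rV[K]_3} -> S)
    (A : {fset {vspace 'rV[K]_3}}) : S :=
  \prod_(L <- A) alpha L.

Definition D0 (alpha : {vspace 'rV[K]_3} -> S) (A : {fset {vspace 'rV[K]_3}})
    (theta : derivation) : Prop :=
  der_app theta (defining_poly alpha A) = 0.

Definition D0_nonzero_in_degree (alpha : {vspace 'rV[K]_3} -> S)
    (A : {fset {vspace 'rV[K]_3}}) (e : nat) : Prop :=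
  exists theta : derivation,
    [/\ D0 alpha A theta, der_homog e theta & theta <> 0].

(* r(A) = r, as a relation: the minimum of a Prop-valued predicate
   on degrees is not computable as a function here. *)
Definition is_r (alpha : {vspace 'rV[K]_3} -> S)
    (A : {fset {vspace 'rV[K]_3}}) (r : nat) : Prop :=
  D0_nonzero_in_degree alpha A r /\
  forall e : nat, D0_nonzero_in_degree alpha A e -> (r <= e)%N.

Definition restriction (A : {fset {vspace 'rV[K]_3}})
    (H : {vspace 'rV[K]_3}) : {fset {vspace 'rV[K]_3}} :=
  [fset (H :&: L)%VS | L in A `\ H].

End Arrangements.

(* Main.v *)
Require Import Defs.
From mathcomp Require Import all_boot all_order all_algebra.
From mathcomp Require Import finmap mpoly.
From mathcomp Require Import ring.

Set Implicit Arguments.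
Unset Strict Implicit.
Unset Printing Implicit Defensive.

(** Write [E] for the Euler derivation, [a_L] for the chosen form of [L], [Q']
    and [Q] for the defining polynomials of [A'] and [A], [n'] and [n] for the
    numbers of planes.

    Degree [r' + 1] is reached. If [th'] kills [Q'], then [a_H th'] maps [Q]
    to [th'(a_H) Q], and so does [(th'(a_H) / n) E] because [E Q = n Q]; the
    difference kills [Q] ([D0_add_plane]). It is nonzero because no nonzero
    multiple of [E] kills [Q'] ([D0_not_euler]).

    No degree [e <= r'] is reached. If [th] kills [Q], then [a_L] divides
    [th(a_L)] for every [L] in [A] ([D0_vanishes_on]). With
    [th(a_H) = a_H h], the derivation [ph = th + (h / n') E] kills [Q'], is
    nonzero of the same degree and still maps [a_H] into the ideal of [a_H]
    ([D0_delete_plane]); hence [r' <= e]. Suppose [e = r']. At a point [P] of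
    a line [H :&: L] the vector [ph(P)] lies in both [H] and [L], so it is
    proportional to [P]. The minors [ph_i X_j - ph_j X_i], of degree [e + 1],
    thus vanish on at least [e + 2] lines of the plane [H], and therefore on
    all of [H] ([homog_vanishes_on_plane]). So modulo [a_H] the
    derivation [ph] is parallel to [E], and
    [0 = X_j ph(Q') = ph_j E(Q') = n' ph_j Q'] on [H]. As [Q'] does not vanish
    on [H], every [ph_j] does ([D0_vanishes_on_plane]). Dividing [ph] by [a_H]
    gives a nonzero derivation of degree [r' - 1] that kills [Q'], against the
    minimality of [r'] ([D0_descent]).

    Since the field is infinite, divisibility by [a_L] is the same as vanishing
    at the points of [L] ([vanishes_on_dvd]), and the argument is carried out
    with values at points. *)

Import GRing.Theory.
Local Open Scope ring_scope.

(** * Polynomials determined by their values *)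

(** Identities between ring morphisms out of a polynomial ring need only be
    checked on constants and variables; this principle also covers
    derivations. *)
Lemma mpoly_ring_ind (R : comNzRingType) (n : nat) (P : {mpoly R[n]} -> Prop) :
  (forall c, P c%:MP) -> (forall i, P 'X_i) ->
  (forall f g, P f -> P g -> P (f + g)) ->
  (forall f g, P f -> P g -> P (f * g)) ->
  forall f, P f.
Proof.
move=> PC PX PD PM; elim/mpolyind => [|c m f _ _ Pf]; first by rewrite -mpolyC0.
apply: (PD) => //; rewrite -mul_mpolyC; apply: (PM) => //.
rewrite mpolyXE_id; apply: (big_ind P) => [||i _].
- by rewrite -mpolyC1.
- exact: PM.
elim: (m i) => [|k IH]; first by rewrite expr0 -mpolyC1.
by rewrite exprS; apply: PM.
Qed.

(** The restriction of [f] to the affine line [v + t w], as a polynomial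
    in [t]. *)
Definition line_poly (R : comNzRingType) (n : nat) (v w : 'I_n -> R)
    (f : {mpoly R[n]}) : {poly R} :=
  mmap polyC (fun i => (v i)%:P + (w i)%:P * 'X) f.

Lemma horner_line_poly (R : comNzRingType) (n : nat) (v w : 'I_n -> R) f t :
  (line_poly v w f).[t] = f.@[fun i => v i + w i * t].
Proof.
rewrite /line_poly; elim/mpoly_ring_ind: f => [c|i|f g IHf IHg|f g IHf IHg].
- by rewrite mmapC hornerC mevalC.
- by rewrite mmapX mmap1U !hornerE mevalXU.
- by rewrite mmapD hornerD IHf IHg mevalD.
- by rewrite rmorphM /= hornerM IHf IHg mevalM.
Qed.

(** The chain rule along a line in a coordinate direction. *)
Lemma deriv_line_poly (R : comNzRingType) (n : nat) (v : 'I_n -> R) (i : 'I_n)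
    (f : {mpoly R[n]}) :
  (line_poly v (fun j => (j == i)%:R) f)^`() =
  line_poly v (fun j => (j == i)%:R) f^`M(i).
Proof.
rewrite /line_poly; elim/mpoly_ring_ind: f => [c|j|f g IHf IHg|f g IHf IHg].
- by rewrite mderivC raddf0 mmapC derivC.
- rewrite mderivX mmapZ !mmapX mmap1U derivD derivM !derivC derivX mnm1E.
  rewrite mul0r !add0r mulr1.
  case: (eqVneq j i) => [->|ji]; last by rewrite polyC0 mul0r.
  have -> : (U_(i) - U_(i) = 0 :> 'X_{1.. n})%MM.
    by apply/mnmP => k; rewrite mnmBE mnm0E subnn.
  by rewrite mmap11 mulr1.
- by rewrite mderivD !mmapD derivD IHf IHg.
- by rewrite mderivM mmapD !rmorphM /= derivM IHf IHg.
Qed.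

Lemma size_line_poly (R : idomainType) (n : nat) (v w : 'I_n -> R) d
    (f : {mpoly R[n]}) :
  f \is d.-homog -> (size (line_poly v w f) <= d.+1)%N.
Proof.
move=> /dhomogP fd; rewrite /line_poly /mmap big_seq.
apply: (big_ind (fun p : {poly R} => size p <= d.+1)%N) => [|p q Hp Hq|m mf].
- by rewrite size_poly0.
- by apply: leq_trans (size_polyD _ _) _; rewrite geq_max Hp.
rewrite mul_polyC; apply: leq_trans (size_scale_leq _ _) _.
have -> : d = (\sum_(i < n) m i)%N by rewrite -(fd _ mf) /= mdegE.
rewrite /mmap1.
apply: (big_ind2 (fun (p : {poly R}) (a : nat) => size p <= a.+1)%N)
  => [|p a q b Hp Hq|i _].
- by rewrite size_poly1.
- apply: leq_trans (size_polyMleq _ _) _.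
  by rewrite -subn1 leq_subLR add1n -addSn -addnS leq_add.
have lin2 : (size ((v i)%:P + (w i)%:P * 'X)%R <= 2)%N.
  apply: leq_trans (size_polyD _ _) _; rewrite geq_max.
  rewrite (leq_trans (size_polyC_leq1 _)) //=.
  rewrite mul_polyC.
  by apply: leq_trans (size_scale_leq _ _) _; rewrite size_polyX.
apply: leq_trans (size_poly_exp_leq _ _) _.
by rewrite ltnS -[leqRHS]mul1n leq_mul2r -subn1 leq_subLR lin2 orbT.
Qed.

Lemma meval_scale (R : comNzRingType) (n d : nat) (f : {mpoly R[n]}) (s : R)
    (v : 'I_n -> R) :
  f \is d.-homog -> f.@[fun i => s * v i] = s ^+ d * f.@[v].
Proof.
move=> /dhomogP fd; rewrite !mevalE mulr_sumr !big_seq.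
apply: eq_bigr => m mf; rewrite mulrCA; congr (_ * _).
have -> : d = (\sum_(i < n) m i)%N by rewrite -(fd _ mf) /= mdegE.
rewrite -prodrXr -big_split /=.
by apply: eq_bigr => i _; rewrite exprMn.
Qed.

(** In characteristic zero the nonzero integers are infinitely many roots.
    The value at 0 is left out of the hypothesis so that the lemma serves
    after a division by [t]. *)
Lemma poly_vanish0 (K : fieldType) (charK0 : [pchar K] =i pred0)
    (p : {poly K}) :
  (forall t, t != 0 -> p.[t] = 0) -> p = 0.
Proof.
move=> p0; apply/eqP; apply: contraT => pn0.
pose rs : seq K := [seq k.+1%:R | k <- iota 0 (size p)].
suff: (size rs < size p)%N by rewrite size_map size_iota ltnn.
have nat0 := proj1 (pcharf0P K) charK0.
apply: max_poly_roots => //.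
  by apply/allP => _ /mapP[k _ ->]; apply/rootP/p0; rewrite nat0.
rewrite map_inj_uniq ?iota_uniq // => i j.
have inj_le a b : (a <= b)%N -> a.+1%:R = b.+1%:R :> K -> a = b.
  move=> ab /esym/eqP; rewrite -subr_eq0 -natrB // nat0 subn_eq0 ltnS => ba.
  by apply/eqP; rewrite eqn_leq ab.
by case: (leqP i j) => [/inj_le//|/ltnW/inj_le ji /esym/ji].
Qed.

(** If [f] vanishes identically, so do its partial derivatives, by restriction
    to the lines in coordinate directions. The value at 0 of the derivative
    with exponent [m] is the coefficient of ['X_[m]] times a product of
    factorials, which is invertible in characteristic zero. *)
Lemma mpoly_vanish0 (K : fieldType) (charK0 : [pchar K] =i pred0) (n : nat)
    (f : {mpoly K[n]}) :
  (forall v, f.@[v] = 0) -> f = 0.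
Proof.
move=> f0.
have der0 (g : {mpoly K[n]}) i :
    (forall v, g.@[v] = 0) -> forall v, g^`M(i).@[v] = 0.
  move=> g0 v; have := horner_line_poly v (fun j => (j == i)%:R) g^`M(i) 0.
  rewrite -deriv_line_poly.
  have -> : line_poly v (fun j => (j == i)%:R) g = 0.
    by apply: poly_vanish0 => // t _; rewrite horner_line_poly g0.
  rewrite deriv0 horner0 => ->; apply: meval_eq => j.
  by rewrite mulr0 addr0.
have ders0 m v : f^`M[m].@[v] = 0.
  rewrite mderivm_foldr /=; elim: (flatten _) v => //= i s IH v.
  exact: der0.
apply/mpolyP => m; rewrite mcoeff0.
have := ders0 m (fun=> 0).
have -> (g : {mpoly K[n]}) : g.@[fun=> 0] = g@_0.
  elim/mpoly_ring_ind: g => [c|i|g h IHg IHh|g h IHg IHh].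
  - by rewrite mevalC mcoeffC eqxx mulr1.
  - by rewrite mevalXU mcoeffX mnm1_eq0.
  - by rewrite mevalD mcoeffD IHg IHh.
  - by rewrite mevalM rmorphM /= IHg IHh.
rewrite mcoeff_mderivm addm0 => /eqP; rewrite -mulr_natr mulf_eq0.
case/orP => [/eqP//|]; rewrite (proj1 (pcharf0P K) charK0).
by case/idPn; rewrite -lt0n prodn_gt0 // => i; rewrite ffactnn fact_gt0.
Qed.

(** * Vanishing on planes and lines of the affine space *)

Lemma linear_formE (R : comNzRingType) (n : nat) (a : {mpoly R[n]}) :
  a \is 1.-homog -> a = \sum_(i < n) a@_U_(i) *: 'X_i.
Proof.
move=> a1; apply/mpolyP => m; rewrite raddf_sum /=.
under eq_bigr => i _ do rewrite mcoeffZ mcoeffX.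
have [/mdeg1P[j /eqP->]|m1] := boolP (mdeg m == 1%N).
  rewrite (bigD1 j) //= eqxx mulr1 big1 ?addr0 // => i ij.
  by rewrite eq_mnm1 (negbTE ij) mulr0.
rewrite (dhomog_nemf_coeff a1) // big1 // => i _.
case: eqP => [im|_]; last by rewrite mulr0.
by rewrite -im mdeg1 in m1.
Qed.

Lemma meval_linear (R : comNzRingType) (n : nat) (a : {mpoly R[n]}) v :
  a \is 1.-homog -> a.@[v] = \sum_(i < n) a@_U_(i) * v i.
Proof.
move=> a1; rewrite {1}(linear_formE a1) raddf_sum /=.
by apply: eq_bigr => i _; rewrite mevalZ mevalXU.
Qed.

Section Planes.
Variables (K : fieldType).
Local Notation S := {mpoly K[3]}.
Implicit Types (H L : {vspace 'rV[K]_3}) (a f g : S).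

Definition vanishes_on L f := forall v : 'rV[K]_3, v \in L -> f.@[v 0] = 0.

Lemma defining_form_neq0 L a : plane L -> defining_form L a -> a != 0.
Proof.
move=> pL [_ aL]; apply: contra_eq_neq pL => a0.
have -> : L = fullv.
  by apply/vspaceP => v; rewrite memvf; apply/aL; rewrite a0 meval0.
by rewrite dimvf.
Qed.

(** A form [a] with kernel [L] has a nonzero coefficient [c] at some ['X_k].
    Replacing ['X_k] by ['X_k - a / c] amounts to composing with a linear
    projection onto [L], and changes nothing modulo [a]. So the ideal of [L] is
    the kernel of this substitution; it is prime, as the target is a domain,
    and generated by [a]. *)
Lemma plane_substitution L a :
  [pchar K] =i pred0 -> plane L -> defining_form L a ->
  exists2 s : {rmorphism S -> S},
    forall f, vanishes_on L f <-> s f = 0 & forall f, exists g, f - s f = a * g.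
Proof.
move=> charK0 pL La; have a0 := defining_form_neq0 pL La; case: La => a1 aL.
have [k ck0] : exists k : 'I_3, a@_U_(k) != 0.
  apply/existsP; apply: contraT => /existsPn ck.
  case/eqP: a0; rewrite (linear_formE a1) big1 // => i _.
  by have /negPn/eqP-> := ck i; rewrite scale0r.
set c := a@_U_(k) in ck0.
pose lq := [tuple 'X_i - (i == k)%:R / c *: a | i < 3].
exists (comp_mpoly lq : {rmorphism S -> S}) => /= f; last first.
  elim/mpoly_ring_ind: f => [d|i|f g [f' IHf] [g' IHg]|f g [f' IHf] [g' IHg]].
  - by exists 0; rewrite comp_mpolyC subrr mulr0.
  - exists ((i == k)%:R / c)%:MP.
    by rewrite comp_mpolyXU -tnth_nth tnth_mktuple subKr [RHS]mulrC mul_mpolyC.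
  - by exists (f' + g'); rewrite rmorphD /= mulrDr -IHf -IHg; ring.
  - exists (f' * g + comp_mpoly lq f * g'); rewrite rmorphM /= mulrDr.
    rewrite mulrA -IHf mulrCA -IHg; ring.
(* [w] is the projection of [v] onto [L] along the [k]-th axis. *)
have projE (v : 'I_3 -> K) : exists2 w : 'rV[K]_3, w \in L &
    (f \mPo lq).@[v] = f.@[w 0] /\ (a.@[v] = 0 -> forall i, w 0 i = v i).
  exists (\row_i (v i - (i == k)%:R / c * a.@[v])).
    apply/aL; rewrite meval_linear //.
    under eq_bigr => i _ do rewrite mxE mulrBr.
    rewrite sumrB -meval_linear // (bigD1 k) //= big1 ?addr0.
      by rewrite eqxx div1r mulrA divff // mul1r subrr.
    by move=> i /negbTE ->; rewrite !mul0r mulr0.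
  split=> [|av0 i]; last by rewrite mxE av0 mulr0 subr0.
  rewrite comp_mpoly_meval; apply: meval_eq => i.
  by rewrite tnth_mktuple mxE mevalB mevalXU mevalZ.
split=> [f0|sf0 v vL].
  apply: mpoly_vanish0 => // v.
  by have [w wL [-> _]] := projE v; apply: f0.
have [w _ [e]] := projE (v 0); move/(_ (proj1 (aL v) vL)) => wv.
by rewrite -(meval_eq _ wv) -e sf0 meval0.
Qed.

Lemma vanishes_onM L a f g :
  [pchar K] =i pred0 -> plane L -> defining_form L a ->
  vanishes_on L (f * g) -> vanishes_on L f \/ vanishes_on L g.
Proof.
move=> charK0 pL La; have [s sP _] := plane_substitution charK0 pL La.
move/sP/eqP; rewrite rmorphM mulf_eq0 => /orP[] /eqP ?; [left|right]; exact/sP.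
Qed.

Lemma vanishes_on_dvd L a f :
  [pchar K] =i pred0 -> plane L -> defining_form L a ->
  vanishes_on L f -> exists g, f = a * g.
Proof.
move=> charK0 pL La; have [s sP dvd] := plane_substitution charK0 pL La.
by move/sP => sf0; have [g] := dvd f; rewrite sf0 subr0 => ->; exists g.
Qed.

Lemma plane_cap H L : plane H -> plane L -> H != L -> \dim (H :&: L) = 1%N.
Proof.
move=> pH pL HL; have := dimv_sum_cap H L; rewrite pH pL => e.
have : (\dim (H + L) <= 3)%N by rewrite (leq_trans (dimvS (subvf _))) ?dimvf.
have : (\dim (H :&: L) < 2)%N.
  rewrite ltnNge; apply: contra HL => d.
  have /eqP HLH : (H :&: L == H)%VS by rewrite eqEdim capvSl pH.
  by rewrite eqEdim pH pL leqnn andbT -HLH capvSr.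
by move: e; case: (\dim (H :&: L)) => [|[|//]] //; rewrite addn0 => ->.
Qed.

Lemma vline_mem (M : {vspace 'rV[K]_3}) w :
  \dim M = 1%N -> w \in M -> w != 0 -> M = <[w]>%VS.
Proof.
move=> dM wM w0; apply/esym/eqP; rewrite eqEdim dM dim_vline w0 leqnn andbT.
by rewrite -memvE.
Qed.

(** Each line [M] of [H] that avoids [v] is a complement of [<[v]>] in [H], so
    it meets [u + <[v]>]. Distinct lines meet it in distinct points since two
    of them share only the origin. *)
Lemma line_intersections H (ms : seq {vspace 'rV[K]_3}) u v :
  plane H -> uniq ms -> u \in H -> v \in H -> u \notin <[v]>%VS ->
  (forall M, M \in ms -> [/\ (M <= H)%VS, \dim M = 1%N & v \notin M]) ->
  exists rs : seq K, [/\ size rs = size ms, uniq rs &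
    forall r, r \in rs -> exists2 M, M \in ms & u + r *: v \in M].
Proof.
move=> pH + uH vH uv; elim: ms => [|M ms IH] /=.
  by move=> _ _; exists [::].
case/andP => Mms ums msP.
have [M'|rs [szrs urs rsP]] := IH ums.
  by move=> M'ms; apply: msP; rewrite inE M'ms orbT.
have [MH dM vM] : [/\ (M <= H)%VS, \dim M = 1%N & v \notin M].
  by apply: msP; rewrite mem_head.
have v0 : v != 0 by apply: contraNneq vM => ->; rewrite mem0v.
have [r rM] : exists r, u + r *: v \in M.
  have /eqP MvH : (M + <[v]> == H)%VS.
    rewrite eqEdim subv_add MH -memvE vH pH.
    have : (M :&: <[v]> = 0)%VS.
      apply/eqP; rewrite -subv0; apply/subvP => w /memv_capP[wM /vlineP[k wk]].
      rewrite memv0; apply: contraNT vM => w0.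
      have k0 : k != 0 by apply: contraNneq w0 => k0; rewrite wk k0 scale0r.
      by rewrite -[v](scalerK k0) -wk memvZ.
    move/dimv_disjoint_sum => ->.
    by rewrite dM dim_vline v0.
  move: uH; rewrite -MvH => /memv_addP[w wM [_ /vlineP[k ->] ->]].
  by exists (- k); rewrite scaleNr addrK.
exists (r :: rs); split; rewrite /= ?szrs //.
  rewrite urs andbT; apply: contra Mms => /rsP[M' M'ms rM'].
  have [_ dM' _] : [/\ (M' <= H)%VS, \dim M' = 1%N & v \notin M'].
    by apply: msP; rewrite inE M'ms orbT.
  have w0 : u + r *: v != 0.
    apply: contraNneq uv => /eqP; rewrite addr_eq0 => /eqP->.
    by rewrite -scaleNr memvZ // memv_line.
  by rewrite (vline_mem dM rM w0) -(vline_mem dM' rM' w0).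
move=> t; rewrite inE => /orP[/eqP->|/rsP[M' M'ms ?]].
  by exists M; rewrite ?mem_head.
by exists M'; rewrite // inE M'ms orbT.
Qed.

(** A nonzero binary form of degree [d] has at most [d] zeros on the projective line.
    For [v] in [H] on none of the lines, [f (u + t v)] has too many roots [t],
    hence is identically zero, and by homogeneity so is [f (v + t u)] for
    nonzero [t]. This yields [f v = 0], the point at infinity of the first
    affine line. *)
Lemma homog_vanishes_on_plane H (ms : seq {vspace 'rV[K]_3}) d f :
  [pchar K] =i pred0 -> plane H -> uniq ms -> (d < size ms)%N ->
  (forall M, M \in ms -> [/\ (M <= H)%VS, \dim M = 1%N & vanishes_on M f]) ->
  f \is d.-homog -> vanishes_on H f.
Proof.
move=> charK0 pH ums dms msP fd v vH.
have [/hasP[M Mms vM]|/hasPn vms] :=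
  boolP (has (fun M : {vspace 'rV[K]_3} => v \in M) ms).
  by have [_ _] := msP M Mms; apply.
have [u uH uv] : exists2 u, u \in H & u \notin <[v]>%VS.
  apply/subvPn; apply: contraTN isT => /dimvS; rewrite pH dim_vline.
  by case: (v != 0).
have [|rs [szrs urs rsP]] := line_intersections pH ums uH vH uv.
  by move=> M Mms; have [? ? _] := msP M Mms; split=> //; apply: vms.
have puv0 : line_poly (u 0) (v 0) f = 0.
  apply/eqP; apply: contraTT dms => pn0; rewrite -leqNgt -szrs.
  rewrite -ltnS; apply: leq_trans (size_line_poly (u 0) (v 0) fd).
  apply: max_poly_roots => //.
  apply/allP => r /rsP[M Mms rM]; apply/rootP; rewrite horner_line_poly.
  have [_ _ /(_ _ rM)] := msP M Mms; apply: etrans; apply: meval_eq => i.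
  by rewrite !mxE mulrC.
have pvu0 : line_poly (v 0) (u 0) f = 0.
  apply: poly_vanish0 => // t t0; rewrite horner_line_poly.
  rewrite (meval_eq (v2 := fun i => t * (u 0 i + v 0 i * t^-1))).
    by rewrite (meval_scale _ _ fd) -horner_line_poly puv0 horner0 mulr0.
  by move=> i; field.
rewrite -[RHS](horner0 0) -pvu0 horner_line_poly; apply: meval_eq => i.
by rewrite mulr0 addr0.
Qed.

End Planes.

(** * Homogeneity and division by a linear form *)

Lemma pihomog_mul_linear (R : comNzRingType) (n e : nat) (a g : {mpoly R[n]}) :
  a \is 1.-homog -> pihomog mdeg e.+1 (a * g) = a * pihomog mdeg e g.
Proof.
move=> a1; have gk : (msize g <= maxn (msize g) e.+1)%N by rewrite leq_maxl.
have ek : (e < maxn (msize g) e.+1)%N by rewrite leq_max leqnn orbT.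
rewrite {1}(pihomog_partitionE gk) mulr_sumr raddf_sum /=.
rewrite (bigD1 (Ordinal ek)) //= big1 ?addr0 => [|d de].
  by rewrite pihomog_dE // -add1n dhomogM ?pihomogP.
apply: (@pihomog_ne0 _ _ _ (1 + d)%N) => //.
by rewrite dhomogM ?pihomogP.
Qed.

Lemma homog_cofactor (R : idomainType) (n e : nat) (a g : {mpoly R[n]}) :
  a \is 1.-homog -> a != 0 -> g != 0 -> a * g \is e.-homog ->
  exists2 d, e = d.+1 & g \is d.-homog.
Proof.
move=> a1 a0 g0 age; have ag0 : a * g != 0 by rewrite mulf_neq0.
have size_homog d (p : {mpoly R[n]}) :
    p != 0 -> p \is d.-homog -> msize p = d.+1.
  move=> p0 pd; rewrite -(prednK (n := msize p)) ?lt0n ?msize_poly_eq0 //.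
  by rewrite (dhomog_uniq p0 pd (dhomog_msize pd)).
have := msizeM a0 g0; rewrite (size_homog 1%N a) // (size_homog e (a * g)) //.
case: e age => [|e] age.
  by have := g0; rewrite -msize_poly_eq0; case: (msize g).
move=> _; exists e => //.
rewrite (_ : g = pihomog mdeg e g) ?pihomogP //.
by apply: (mulfI a0); rewrite -pihomog_mul_linear // pihomog_dE.
Qed.

(** * Derivations and the Euler field *)

Section Derivations.
Variables (K : fieldType).
Local Notation S := {mpoly K[3]}.
Implicit Types (H L : {vspace 'rV[K]_3}) (a f g p q : S).
Implicit Types (th eta : derivation K).

Lemma der_appM th f g :
  der_app th (f * g) = der_app th f * g + f * der_app th g.
Proof.
rewrite /der_app mulr_suml mulr_sumr -big_split /=; apply: eq_bigr => i _.
by rewrite mderivM; ring.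
Qed.

Lemma der_app1 th : der_app th 1 = 0.
Proof. by rewrite /der_app big1 // => i _; rewrite -mpolyC1 mderivC mulr0. Qed.

Lemma der_app_linear th a :
  a \is 1.-homog -> der_app th a = \sum_(i < 3) a@_U_(i) *: th i.
Proof.
move=> a1; apply: eq_bigr => i _.
rewrite [in LHS](linear_formE a1) raddf_sum /=.
rewrite (bigD1 i) //= big1 => [|j ji]; rewrite mderivZ mderivX mnm1E.
  rewrite eqxx scale1r addr0 (_ : U_(i) - U_(i) = 0)%MM ?mpolyX0.
    by rewrite -scalerAr mulr1.
  by apply/mnmP => k; rewrite mnmBE mnm0E subnn.
by rewrite (negbTE ji) scale0r scaler0.
Qed.

Definition euler : derivation K := [ffun i => 'X_i].

Definition der_comb p th q eta : derivation K :=
  [ffun i => p * th i + q * eta i].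

Lemma der_app_comb p th q eta f :
  der_app (der_comb p th q eta) f = p * der_app th f + q * der_app eta f.
Proof.
rewrite /der_app !mulr_sumr -big_split /=; apply: eq_bigr => i _.
by rewrite ffunE; ring.
Qed.

Lemma der_app_euler_linear a : a \is 1.-homog -> der_app euler a = a.
Proof.
move=> a1; rewrite der_app_linear // [RHS]linear_formE //.
by apply: eq_bigr => i _; rewrite ffunE.
Qed.

Lemma homog_der_app_linear d th a :
  a \is 1.-homog -> der_homog d th -> der_app th a \is d.-homog.
Proof.
move=> a1 thd; rewrite der_app_linear //; apply: rpred_sum => i _.
exact: dhomogZ.
Qed.

Lemma meval_der_app_linear th a v :
  a \is 1.-homog -> (der_app th a).@[v] = a.@[fun i => (th i).@[v]].
Proof.
move=> a1; rewrite der_app_linear // (meval_linear _ a1) raddf_sum /=.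
by apply: eq_bigr => i _; rewrite mevalZ.
Qed.

Lemma derivation_eq0 th : (forall i, th i = 0) -> th = 0.
Proof. by move=> th0; apply/ffunP => i; rewrite th0 ffunE. Qed.

Lemma derivation_neq0 th : th <> 0 -> exists i, th i != 0.
Proof.
move=> th0; apply/existsP; apply: contraPT th0 => /existsPn h.
by apply; apply: derivation_eq0 => i; apply/eqP/negPn/h.
Qed.

(** * Derivations killing the defining polynomial *)

Section Arrangement.
Variables (alpha : {vspace 'rV[K]_3} -> S).
Hypothesis charK0 : [pchar K] =i pred0.
Implicit Types (A : {fset {vspace 'rV[K]_3}}).

Definition defining_forms A := forall L, L \in A -> defining_form L (alpha L).

Lemma der_app_euler_defining_poly A : defining_forms A ->
  der_app euler (defining_poly alpha A) =
  (#|` A|)%:R * defining_poly alpha A.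
Proof.
move=> fA.
rewrite /defining_poly; have: {subset enum_fset A <= A} by [].
elim: (enum_fset A) => [|L s IH] sA; first by rewrite big_nil der_app1 mul0r.
have [a1 _] : defining_form L (alpha L) by apply/fA/sA/mem_head.
rewrite big_cons der_appM der_app_euler_linear // IH => [|M Ms].
  by rewrite /= (natrD _ 1); ring.
by apply: sA; rewrite inE Ms orbT.
Qed.

Lemma defining_poly_neq0 A :
  arrangement A -> defining_forms A -> defining_poly alpha A != 0.
Proof.
move=> pA fA; rewrite /defining_poly big_seq prodf_seq_neq0.
apply/allP => L LA; apply/implyP => _.
exact: defining_form_neq0 (pA L LA) (fA L LA).
Qed.

(** The ideal of [L] is prime, so some factor vanishes on [L]; its kernel
    is then [L], for reasons of dimension. *)
Lemma vanishes_on_defining_poly A L :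
  arrangement A -> defining_forms A -> plane L -> defining_form L (alpha L) ->
  vanishes_on L (defining_poly alpha A) -> L \in A.
Proof.
move=> pA fA pL fL; rewrite /defining_poly big_seq.
apply: (big_ind (fun f => vanishes_on L f -> L \in A)).
- move/(_ 0); rewrite mem0v meval1 => /(_ isT)/eqP; by rewrite oner_eq0.
- by move=> f g IHf IHg /(vanishes_onM charK0 pL fL)[].
move=> M MA vLM; suff -> : L = M by [].
apply/eqP; rewrite eqEdim (pA M MA) pL leqnn andbT.
by apply/subvP => v /vLM; have [_ fM] := fA M MA; move/fM.
Qed.

(** Write [Q = a_L R]. Then [0 = th(a_L) R + a_L th(R)], so [th(a_L) R] vanishes
    on [L], while [R] does not. *)
Lemma D0_vanishes_on A th L :
  arrangement A -> defining_forms A -> D0 alpha A th -> L \in A ->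
  vanishes_on L (der_app th (alpha L)).
Proof.
move=> pA fA + LA; have [pL fL] := (pA L LA, fA L LA).
pose B := (A `\ L)%fset.
have QE : defining_poly alpha A = alpha L * defining_poly alpha B.
  by rewrite /defining_poly (big_fsetD1 L).
rewrite /D0 QE der_appM => th0.
have [] // := vanishes_onM charK0 pL fL
                (f := der_app th (alpha L)) (g := defining_poly alpha B).
- move=> v vL; have := congr1 (meval (v 0)) th0.
  rewrite meval0 mevalD !mevalM.
  by have [_ /(_ v)[/(_ vL)-> _]] := fL; rewrite mul0r addr0.
- have BA M : M \in B -> M \in A by rewrite inE => /andP[].
  have pB : arrangement B by move=> M /BA/pA.
  have fB : defining_forms B by move=> M /BA/fA.
  by move=> /(vanishes_on_defining_poly pB fB pL fL); rewrite !inE eqxx.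
Qed.

(** Both sides are evaluated at [Q]: the left one gives 0, the right one
    [q] times [#|A| Q], which is nonzero unless [q] is. *)
Lemma D0_not_euler A th p q :
  arrangement A -> defining_forms A -> (0 < #|` A|)%N ->
  D0 alpha A th -> (forall i, p * th i = q * 'X_i) -> q = 0.
Proof.
move=> pA fA A0 th0 pq.
have := congr1 (fun f => p * f) th0; rewrite /der_app mulr0 mulr_sumr.
under eq_bigr => i _ do rewrite mulrA pq -mulrA.
rewrite -mulr_sumr.
have := der_app_euler_defining_poly fA; rewrite /der_app.
under eq_bigr => i _ do rewrite ffunE.
move=> -> /eqP; rewrite !mulf_eq0 (negbTE (defining_poly_neq0 pA fA)) orbF.
rewrite -mpolyC_nat mpolyC_eq0 (proj1 (pcharf0P K) charK0) eqn0Ngt A0 orbF.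
by move/eqP.
Qed.

(** The derivation [a_H th] multiplies [a_H Q] by [th(a_H)]; the
    multiple of the Euler derivation cancels this factor. *)
Lemma D0_add_plane A H th :
  let A1 := (H |` A)%fset in
  arrangement A1 -> defining_forms A1 -> H \notin A ->
  D0 alpha A th ->
  D0 alpha A1 (der_comb (alpha H) th
    (- ((#|` A1|)%:R^-1 *: der_app th (alpha H))) euler).
Proof.
move=> A1 pA1 fA1 HA thA.
have n0 : (#|` A1|)%:R != 0 :> K.
  by rewrite (proj1 (pcharf0P K) charK0) cardfsU1 HA.
rewrite /D0 der_app_comb der_app_euler_defining_poly //.
have -> : defining_poly alpha A1 = alpha H * defining_poly alpha A.
  by rewrite /defining_poly big_fsetU1.
rewrite der_appM thA mulr0 addr0 -mpolyC_nat mul_mpolyC -scaleNr.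
rewrite -scalerAl -scalerAr scalerA mulNr mulVf // scaleN1r; ring.
Qed.

(** From [0 = th(a_H Q) = a_H (h Q + th(Q))] the derivation [th] multiplies
    [Q] by [- h], which the multiple of the Euler derivation cancels. *)
Lemma D0_delete_plane A H th h :
  let A1 := (H |` A)%fset in
  arrangement A1 -> defining_forms A1 -> H \notin A -> (0 < #|` A|)%N ->
  D0 alpha A1 th -> der_app th (alpha H) = alpha H * h ->
  D0 alpha A (der_comb 1 th ((#|` A|)%:R^-1 *: h) euler).
Proof.
move=> A1 pA1 fA1 HA A0 thA1 hE.
have aH0 : alpha H != 0.
  by apply: (@defining_form_neq0 _ H); [apply: pA1|apply: fA1]; rewrite fset1U1.
have fA : defining_forms A by move=> L LA; apply: fA1; rewrite fset1Ur.
have n0 : (#|` A|)%:R != 0 :> K.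
  by rewrite (proj1 (pcharf0P K) charK0) -lt0n.
rewrite /D0 der_app_comb der_app_euler_defining_poly // mul1r.
rewrite -mpolyC_nat mul_mpolyC -scalerAl -scalerAr scalerA mulVf // scale1r.
apply: (mulfI aH0); rewrite mulr0 -[RHS]thA1.
have -> : defining_poly alpha A1 = alpha H * defining_poly alpha A.
  by rewrite /defining_poly big_fsetU1.
rewrite der_appM hE; ring.
Qed.

(** Here the number of points on [H] enters. The restriction of [th] to [H] is
    tangent to [e + 2] lines of [H], too many for the minors of [th] and the
    Euler derivation not to vanish on [H]. A derivation that is parallel to the
    Euler derivation and kills [Q] is zero on [H], since [E Q = #|A| Q] and [Q]
    does not vanish on [H]. *)
Lemma D0_vanishes_on_plane A H th e :
  let A1 := (H |` A)%fset in
  arrangement A1 -> defining_forms A1 -> H \notin A -> (0 < #|` A|)%N ->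
  D0 alpha A th -> der_homog e th -> vanishes_on H (der_app th (alpha H)) ->
  (e + 2 <= #|` restriction A1 H|)%N ->
  forall i, vanishes_on H (th i).
Proof.
move=> A1 pA1 fA1 HA A0 thA the thH manyM.
have fA : defining_forms A by move=> L LA; apply: fA1; rewrite fset1Ur.
have pA : arrangement A by move=> L LA; apply: pA1; rewrite fset1Ur.
have pH : plane H by apply: pA1; rewrite fset1U1.
have fH : defining_form H (alpha H) by apply: fA1; rewrite fset1U1.
(* Tangency to [H] and [L] makes [th] proportional to the position vector. *)
have minor0 i j : vanishes_on H (th i * 'X_j - th j * 'X_i).
  apply: (@homog_vanishes_on_plane _ _ (restriction A1 H) e.+1) => //.
  - exact: fset_uniq.
  - by rewrite -addn2.
  - move=> M /imfsetP[L /= LA1 ->].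
    have {LA1} [LH LA] : L != H /\ L \in A.
      by move: LA1; rewrite !inE => /andP[/[dup] ? /negbTE->].
    have dM : \dim (H :&: L) = 1%N.
      by rewrite plane_cap // 1?eq_sym //; apply: pA.
    split; rewrite ?capvSl // => v vM.
    have [vH vL] := memv_capP vM.
    have [->|v0] := eqVneq v 0.
      by rewrite mevalB !mevalM !mevalXU !mxE !mulr0 subrr.
    pose w : 'rV[K]_3 := \row_k (th k).@[v 0].
    have wE k : (th k).@[v 0] = w 0 k by rewrite mxE.
    have wmem N : defining_form N (alpha N) -> v \in N ->
        vanishes_on N (der_app th (alpha N)) -> w \in N.
      move=> [a1 fN] vN /(_ v vN); rewrite meval_der_app_linear //.
      by rewrite (meval_eq _ wE); apply: (proj2 (fN w)).
    have : w \in (H :&: L)%VS.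
      apply/memv_capP; split; apply: (wmem) => //; first exact: fA.
      exact: D0_vanishes_on pA fA thA LA.
    rewrite (vline_mem dM vM v0) => /vlineP[c wv].
    by rewrite mevalB !mevalM !mevalXU !wE wv !mxE; ring.
  - rewrite -(addn1 e); apply: rpredB; apply: dhomogM => //;
    by rewrite dhomogX; apply/eqP/mdeg1.
move=> j.
(* Vanishing minors allow exchanging [th j * 'X_i] and [th i * 'X_j] in
   [th j * der_app euler Q], which turns it into ['X_j * der_app th Q = 0]. *)
have QH : vanishes_on H (th j * ((#|` A|)%:R * defining_poly alpha A)).
  move=> v vH; rewrite -der_app_euler_defining_poly // /der_app mulr_sumr.
  transitivity (('X_j * der_app th (defining_poly alpha A)).@[v 0]); last first.
    by rewrite thA mulr0 meval0.
  apply/eqP; rewrite -subr_eq0 -mevalB /der_app mulr_sumr -sumrB raddf_sum /=.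
  apply/eqP/big1 => i _; rewrite ffunE.
  rewrite (_ : _ - _ = (th j * 'X_i - th i * 'X_j)
                      * (defining_poly alpha A)^`M(i)); last by ring.
  by rewrite mevalM minor0 ?mul0r.
case: (vanishes_onM charK0 pH fH QH) => // nQ0.
case/negP: HA; apply: vanishes_on_defining_poly => // v vH.
have /eqP := nQ0 v vH; rewrite mevalM -mpolyC_nat mevalC mulf_eq0.
by rewrite (proj1 (pcharf0P K) charK0) eqn0Ngt A0 => /eqP.
Qed.

(** A derivation that vanishes on [H] is divisible by [a_H], and the quotient
    still kills [Q]. *)
Lemma D0_descent A H th e :
  let A1 := (H |` A)%fset in
  arrangement A1 -> defining_forms A1 -> H \notin A -> (0 < #|` A|)%N ->
  D0 alpha A th -> der_homog e th -> vanishes_on H (der_app th (alpha H)) ->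
  (e + 2 <= #|` restriction A1 H|)%N -> th <> 0 ->
  exists d eta, [/\ e = d.+1, D0 alpha A eta, der_homog d eta & eta <> 0].
Proof.
move=> A1 pA1 fA1 HA A0 thA the thH manyM th0.
have pH : plane H by apply: pA1; rewrite fset1U1.
have fH : defining_form H (alpha H) by apply: fA1; rewrite fset1U1.
have aH0 := defining_form_neq0 pH fH.
have /fin_all_exists[g gE] : forall i, exists g, th i = alpha H * g.
  move=> i; apply: (vanishes_on_dvd charK0 pH fH).
  exact: (D0_vanishes_on_plane pA1 fA1 HA A0 thA the).
have [i0 thi0] := derivation_neq0 th0.
have gi0 : g i0 != 0 by apply: contraNneq thi0 => g0; rewrite gE g0 mulr0.
have ge i : alpha H * g i \is e.-homog by rewrite -gE.
have [d ed _] := homog_cofactor (proj1 fH) aH0 gi0 (ge i0).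
exists d, [ffun i => g i]; split=> //.
- apply: (mulfI aH0); rewrite mulr0 -[RHS]thA /der_app mulr_sumr.
  by apply: eq_bigr => i _; rewrite ffunE gE mulrA.
- move=> i; rewrite ffunE; have [->|gi] := eqVneq (g i) 0; first exact: dhomog0.
  have [d'] := homog_cofactor (proj1 fH) aH0 gi (ge i).
  by rewrite ed => -[<-].
- by move/ffunP/(_ i0); rewrite !ffunE => g0; rewrite g0 eqxx in gi0.
Qed.

End Arrangement.
End Derivations.

Lemma arrangement_card_gt0 (K : fieldType) (A : {fset {vspace 'rV[K]_3}}) :
  essential A -> (0 < #|` A|)%N.
Proof.
rewrite cardfs_gt0; apply: contraPneq => -> /eqP.
by rewrite big_seq_fset0 -dimv_eq0 dimvf.
Qed.

Local Open Scope fset_scope.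

Theorem theorem3p3 (K : fieldType) (charK0 : [pchar K] =i pred0)
    (A' : {fset {vspace 'rV[K]_3}}) (H : {vspace 'rV[K]_3})
    (alpha : {vspace 'rV[K]_3} -> {mpoly K[3]}) (r' : nat) :
  let A := H |` A' in
  arrangement A' -> plane H -> H \notin A' ->
  essential A -> essential A' ->
  (forall L, L \in A -> defining_form L (alpha L)) ->
  is_r alpha A' r' ->
  (r' + 2 <= #|` restriction A H|)%N ->
  is_r alpha A (r' + 1)%N.
Proof.
move=> A pA' pH HA' essA essA' fA [[th' [th'D th'r th'0]] minA'] manyH.
have A'0 := arrangement_card_gt0 essA'; have A0 := arrangement_card_gt0 essA.
have HA : H \in A by rewrite fset1U1.
have pA : arrangement A by move=> L; rewrite inE => /orP[/fset1P->|/pA'].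
have fH := fA H HA; have [aH1 aHP] := fH; have aH0 := defining_form_neq0 pH fH.
have fA' : defining_forms alpha A' by move=> L LA'; apply: fA; rewrite fset1Ur.
have X1 i : ('X_i : {mpoly K[3]}) \is 1.-homog.
  by rewrite dhomogX; apply/eqP/mdeg1.
split=> [|e [th [thD the th0]]].
  exists (der_comb (alpha H) th'
    (- ((#|` A|)%:R^-1 *: der_app th' (alpha H))) (euler K)).
  split; first exact: D0_add_plane.
    move=> i; rewrite !ffunE; apply: rpredD.
      by rewrite (addnC r'); apply: dhomogM.
    apply: dhomogM => //; rewrite rpredN dhomogZ //.
    exact: homog_der_app_linear.
  move=> comb0; apply: th'0; apply: derivation_eq0 => i.
  have combE j :
      alpha H * th' j = (#|` A|)%:R^-1 *: der_app th' (alpha H) * 'X_j.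
    have /ffunP/(_ j) := comb0; rewrite !ffunE mulNr => /eqP.
    by rewrite subr_eq0 => /eqP.
  have := combE i; rewrite (D0_not_euler charK0 pA' fA' A'0 th'D combE) mul0r.
  by move/eqP; rewrite mulf_eq0 (negbTE aH0) => /eqP.
have [h hE] :=
  vanishes_on_dvd charK0 pH fH (D0_vanishes_on charK0 pA fA thD HA).
pose q := (#|` A'|)%:R^-1 *: h; pose ph := der_comb 1 th q (euler K).
have phD : D0 alpha A' ph by apply: D0_delete_plane hE.
have phe : der_homog e ph.
  move=> i; rewrite !ffunE mul1r; apply: rpredD => //.
  rewrite -scalerAl dhomogZ //.
  (* The degree [e - 1] of [h] makes no sense for [e = 0]; that of [h * 'X_i]
     is [e] in all cases. *)
  have [->|hX0] := eqVneq (h * 'X_i) 0; first exact: dhomog0.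
  have := dhomogM (homog_der_app_linear aH1 the) (X1 i).
  rewrite hE -mulrA => /(homog_cofactor aH1 aH0 hX0)[d].
  by rewrite addn1 => -[<-].
have ph0 : ph <> 0.
  move=> ph0; apply: th0; apply: derivation_eq0 => i.
  have thE j : 1 * th j = - q * 'X_j.
    have /ffunP/(_ j) := ph0; rewrite !ffunE mulNr => /eqP.
    by rewrite addr_eq0 => /eqP.
  have := thE i; rewrite (D0_not_euler charK0 pA fA A0 thD thE).
  by rewrite mul1r mul0r.
have r'e : (r' <= e)%N by apply: minA'; exists ph.
rewrite addn1 ltn_neqAle r'e andbT; apply/eqP => er'.
have phH : vanishes_on H (der_app ph (alpha H)).
  move=> v vH; rewrite der_app_comb der_app_euler_linear // mul1r hE.
  by rewrite mevalD !mevalM (proj1 (aHP v) vH) mul0r mulr0 addr0.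
have [|d [eta [ed etaD etad eta0]]] :=
  D0_descent charK0 pA fA HA' A'0 phD phe phH _ ph0.
  by rewrite -er'.
have : (r' <= d)%N by apply: minA'; exists eta.
by rewrite er' ed ltnn.
Qed.
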